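(* Let $N\in\mathbb{N}$ and let $\mathbf{X}=(X_1,\ldots,X_N)^T:(\Omega,\mathcal{F})\to(\mathbb{A}^N,\mathcal{B}^N)$ be an $N$-dimensional random vector with multivariate probability density function $f_{\mathbf{X}}(\mathbf{x})$, satisfying Assumption 1 (stated in the context). Then, for each $l\in\mathbb{N}_0$, the set $\{P_{\mathbf{j}}(\mathbf{x}):|\mathbf{j}|=l,\ \mathbf{j}\in\mathbb{N}_0^N\}$ of multivariate orthogonal polynomials of degree $l$ consistent with the probability measure $f_{\mathbf{X}}(\mathbf{x})d\mathbf{x}$ is a basis of $\mathcal{V}_l^N$.
   Context: $\mathbb{N}_0=\{0,1,2,\ldots\}$. $(\Omega,\mathcal{F},\mathbb{P})$ is a complete probability space, $\mathbb{A}^N\subseteq\mathbb{R}^N$ is a bounded or unbounded subdomain, $\mathcal{B}^N$ is its Borel $\sigma$-algebra, and $\mathbb{E}$ is expectation. Assumption 1. The random vector $\mathbf{X}:(\Omega,\mathcal{F})\to(\mathbb{A}^N,\mathcal{B}^N)$ (1) has an absolutely continuous joint distribution function and a continuous joint probability density function $f_{\mathbf{X}}$ with bounded or unbounded support $\mathbb{A}^N\subseteq\mathbb{R}^N$; (2) has absolute finite moments of all orders, i.e. $\int_{\mathbb{A}^N}|\mathbf{x}^{\mathbf{j}}|f_{\mathbf{X}}(\mathbf{x})d\mathbf{x}<\infty$ for all $\mathbf{j}\in\mathbb{N}_0^N$, where $\mathbf{x}^{\mathbf{j}}=x_1^{j_1}\cdots x_N^{j_N}$; (3) has a density $f_{\mathbf{X}}$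 which either (a) has compact support, i.e. there is a compact subset $\mathbb{A}^N\subset\mathbb{R}^N$ with $\mathbb{P}(\mathbf{X}\in\mathbb{A}^N)=1$, or (b) is exponentially integrable, i.e. there is a real $\alpha>0$ with $\int_{\mathbb{A}^N}\exp(\alpha\|\mathbf{x}\|)f_{\mathbf{X}}(\mathbf{x})d\mathbf{x}<\infty$, where $\|\cdot\|$ is an arbitrary norm. For $\mathbf{j}=(j_1,\ldots,j_N)\in\mathbb{N}_0^N$, $|\mathbf{j}|=j_1+\cdots+j_N$. $\Pi_m^N=\mathrm{span}\{\mathbf{x}^{\mathbf{j}}:|\mathbf{j}|\le m\}$ and $\Pi^N=\mathbb{R}[x_1,\ldots,x_N]$. The inner product on $\Pi^N$ is $(P,Q)_{f_{\mathbf{X}}d\mathbf{x}}=\int_{\mathbb{A}^N}P(\mathbf{x})Q(\mathbf{x})f_{\mathbf{X}}(\mathbf{x})d\mathbf{x}$. $\mathcal{V}_0^N=\mathrm{span}\{1\}$ and, for $l\ge1$, $\mathcal{V}_l^N=\{P\in\Pi_l^N:(P,Q)_{f_{\mathbf{X}}d\mathbf{x}}=0\ \forall Q\in\Pi_{l-1}^N\}$. Let $K_{N,l}=\binom{N+l-1}{l}$ be the number of multi-indices with $|\mathbf{j}|=l$, listed in a chosen monomial order as $\mathbf{j}^{(1)},\ldots,\mathbf{j}^{(K_{N,l})}$, and let $\mathbf{x}_l=(\mathbf{x}^{\mathbf{j}^{(1)}},\ldots,\mathbf{x}^{\mathbf{j}^{(K_{N,l})}})^T$. Multivariate orthogonal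 polynomials consistent with $f_{\mathbf{X}}(\mathbf{x})d\mathbf{x}$: a family $\{P_{\mathbf{j}}:\mathbf{j}\in\mathbb{N}_0^N\}$ with $P_{\mathbf{0}}=1$ and $P_{\mathbf{j}}\in\Pi_{|\mathbf{j}|}^N$, such that for each $l$ the column vector $\mathbf{P}_l(\mathbf{x})=(P_{\mathbf{j}^{(1)}}(\mathbf{x}),\ldots,P_{\mathbf{j}^{(K_{N,l})}}(\mathbf{x}))^T$ satisfies $\int_{\mathbb{A}^N}\mathbf{x}_r\mathbf{P}_l^T(\mathbf{x})f_{\mathbf{X}}(\mathbf{x})d\mathbf{x}=\mathbf{0}$ for all $r<l$, and the $K_{N,l}\times K_{N,l}$ matrix $\mathbf{S}_l=\int_{\mathbb{A}^N}\mathbf{x}_l\mathbf{P}_l^T(\mathbf{x})f_{\mathbf{X}}(\mathbf{x})d\mathbf{x}$ is invertible. (Polynomials of the same degree need not be mutually orthogonal.) *)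

(* Defs.v *)
From HB Require Import structures.
From mathcomp Require Import all_boot all_order all_algebra.
(* The notations of mpoly are left out: they clash with those of analysis. *)
From mathcomp Require Import -(notations) mpoly.
From mathcomp Require Import all_classical all_reals all_analysis.
From mathcomp Require Import measurable_realfun.

Set Implicit Arguments.
Unset Strict Implicit.
Unset Printing Implicit Defensive.
Import Order.TTheory GRing.Theory Num.Theory.
Import numFieldNormedType.Exports.
Local Open Scope classical_set_scope.
Local Open Scope ring_scope.

Section borel_rV.
Context {R : realType} {n : nat}.

Let borel : set (set 'rV[R]_n) := <<s @open 'rV[R]_n >>.

Let borel0 : borel set0.
Proof. exact: sigma_algebra0. Qed.

Let borelC A : borel A -> borel (~` A).
Proof. by move=> mA; rewrite -setTD; exact: sigma_algebraCD. Qed.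

Let borel_bigcup (F : (set 'rV[R]_n)^nat) :
  (forall i, borel (F i)) -> borel (\bigcup_i (F i)).
Proof. exact: sigma_algebra_bigcup. Qed.

HB.instance Definition _ := @isMeasurable.Build default_measure_display
  'rV[R]_n borel borel0 borelC borel_bigcup.

Lemma rV_open_measurable (A : set 'rV[R]_n) : open A -> measurable A.
Proof. by move=> oA; exact: sub_sigma_algebra. Qed.

Lemma measurable_coord (i : 'I_n) :
  measurable_fun [set: 'rV[R]_n] (fun x : 'rV[R]_n => x ord0 i).
Proof.
apply: (measurability _ (RGenOInfty.measurableE R)).
move=> _ [_ [a ->] <-]; rewrite setTI; apply: rV_open_measurable.
apply: open_comp; last exact: interval_open.
by move=> x _; exact: coord_continuous.
Qed.

End borel_rV.

(* The Borel sets of R^n are generated by the coordinates. *)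
Lemma measurable_fun_rVP (R : realType) (n : nat) (d : measure_display)
    (T : measurableType d) (f : T -> 'rV[R]_n) :
  measurable_fun [set: T] f <->
  forall i, measurable_fun [set: T] (fun t => f t ord0 i).
Proof.
split=> [mf i|mf].
  exact: (measurableT_comp (measurable_coord i) mf).
have mball (c : 'rV[R]_n) (e : R) : 0 < e -> measurable (f @^-1` ball c e).
  move=> e0.
  have -> : f @^-1` ball c e =
      \bigcap_(i in [set: 'I_n]) ((fun t => f t ord0 i) @^-1` ball (c ord0 i) e).
    apply/seteqP; split=> [t [_ cft] i _|t cft]; first exact: cft.
    by split=> // i j; rewrite ord1; exact: cft.
  apply: fin_bigcap_measurable => // i _.
  by rewrite -[X in measurable X]setTI; apply: mf => //; exact: measurable_ball.
apply: (measurability (@open 'rV[R]_n)) => // _ [U oU <-]; rewrite setTI.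
pose B (q : 'rV[rat]_n * rat) : set 'rV[R]_n :=
  ball (map_mx ratr q.1 : 'rV[R]_n) (ratr q.2 : R).
have -> : U = \bigcup_(q in [set q | 0 < q.2 /\ B q `<=` U]) B q.
  apply/seteqP; split=> [x Ux|x [q [_ qU] /qU//]].
  have /nbhs_ballP[e /= e0 xeU] : nbhs x U by exact: open_nbhs_nbhs.
  have [r] : exists r, ratr r \in `]0, e / 2[%R.
    by apply: rat_in_itvoo; rewrite divr_gt0.
  rewrite in_itv/= => /andP[r0 re].
  have hc (i : 'I_n) : exists c : rat, ratr c \in `](x ord0 i), (x ord0 i + ratr r)[%R.
    by apply: rat_in_itvoo; rewrite ltrDl.
  have [c cP] := choice hc.
  have xc : ball x (ratr r) (map_mx ratr (\row_i c i) : 'rV[R]_n).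
    split=> // i j; rewrite !mxE ord1 /ball/=.
    move: (cP j); rewrite in_itv/= => /andP[c1 c2].
    by rewrite distrC gtr0_norm ?subr_gt0// ltrBlDl.
  exists (\row_i c i, r); last exact: ball_sym.
  split; first by rewrite /= -(@ltr0q R).
  move=> y cy; apply: xeU; rewrite (splitr e).
  by apply: (@ball_triangle _ _ (map_mx ratr (\row_i c i) : 'rV[R]_n)); exact: le_ball (ltW re) _ _.
rewrite preimage_bigcup; rewrite bigcup_mkcond.
apply: countable_bigcupT_measurable; first exact: countableP.
move=> q; case: ifPn => //.
by rewrite inE => -[q0 _]; apply: mball; rewrite ltr0q.
Qed.

Section lebesgue_rV_step.
Context {R : realType} {n : nat}.
Variable mu : {sigma_finite_measure set 'rV[R]_n -> \bar R}.

Definition rV_cons (p : measurableTypeR R * 'rV[R]_n) : 'rV[R]_n.+1 :=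
  \row_(i < n.+1) oapp (p.2 ord0) p.1 (unlift ord0 i).

Lemma rV_cons0 p : rV_cons p ord0 ord0 = p.1.
Proof. by rewrite mxE unlift_none. Qed.

Lemma rV_consS p (i : 'I_n) : rV_cons p ord0 (lift ord0 i) = p.2 ord0 i.
Proof. by rewrite mxE liftK. Qed.

Lemma measurable_rV_cons : measurable_fun setT rV_cons.
Proof.
apply/measurable_fun_rVP => i; case: (unliftP ord0 i) => [j|] ->.
  under eq_fun do rewrite rV_consS.
  by apply: (measurableT_comp (measurable_coord j)); exact: measurable_snd.
by under eq_fun do rewrite rV_cons0; exact: measurable_fst.
Qed.

Definition rV_uncons (v : 'rV[R]_n.+1) : measurableTypeR R * 'rV[R]_n :=
  (v ord0 ord0, \row_(i < n) v ord0 (lift ord0 i)).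

Lemma rV_consK : cancel rV_cons rV_uncons.
Proof.
move=> [x v]; rewrite /rV_uncons rV_cons0/=.
have -> // : \row_i rV_cons (x, v) ord0 (lift ord0 i) = v.
by apply/matrixP => i j; rewrite mxE rV_consS [i]ord1 [ord0]ord1.
Qed.

Lemma rV_unconsK : cancel rV_uncons rV_cons.
Proof.
move=> v; apply/rowP => i; case: (unliftP ord0 i) => [j|] ->.
  by rewrite rV_consS mxE.
by rewrite rV_cons0.
Qed.

Lemma measurable_rV_uncons : measurable_fun setT rV_uncons.
Proof.
apply: measurable_fun_pair; first exact: (measurable_coord ord0).
apply/measurable_fun_rVP => i.
by under eq_fun do rewrite mxE; exact: measurable_coord.
Qed.

Definition lebesgue_rV_cons : set 'rV[R]_n.+1 -> \bar R :=
  pushforward (lebesgue_measure \x mu)%E rV_cons.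

Let cons_pre A : measurable A -> measurable (rV_cons @^-1` A).
Proof.
by move=> mA; rewrite -[X in measurable X]setTI; exact: measurable_rV_cons.
Qed.

Let cons0 : lebesgue_rV_cons set0 = 0%E.
Proof. by rewrite /lebesgue_rV_cons /pushforward preimage_set0 measure0. Qed.

Let cons_ge0 A : (0 <= lebesgue_rV_cons A)%E.
Proof. exact: (measure_ge0 (lebesgue_measure \x mu)%E). Qed.

Let cons_additive : semi_sigma_additive lebesgue_rV_cons.
Proof.
move=> F mF tF mUF; rewrite /lebesgue_rV_cons /pushforward preimage_bigcup.
apply: measure_semi_sigma_additive.
- by move=> k; exact: cons_pre.
- apply/trivIsetP => /= i j _ _ ij; rewrite -preimage_setI.
  by move/trivIsetP : tF => /(_ _ _ _ _ ij) ->//; rewrite preimage_set0.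
- by rewrite -preimage_bigcup; exact: cons_pre.
Qed.

HB.instance Definition _ := isMeasure.Build _ _ _ lebesgue_rV_cons
  cons0 cons_ge0 cons_additive.

Let cons_sigma_finite : sigma_finite setT lebesgue_rV_cons.
Proof.
have /sigma_finiteP[F [TF ndF Foo]] := sigma_finiteT (@lebesgue_measure R).
have /sigma_finiteP[G [TG ndG Goo]] := sigma_finiteT mu.
exists (fun k => rV_uncons @^-1` (F k `*` G k)).
  apply/seteqP; split=> // v _.
  have [k _ Fk] : (\bigcup_k F k) (rV_uncons v).1 by rewrite -TF.
  have [l _ Gl] : (\bigcup_k G k) (rV_uncons v).2 by rewrite -TG.
  exists (maxn k l) => //; split.
    by move: Fk; exact/subsetPset/ndF/leq_maxl.
  by move: Gl; exact/subsetPset/ndG/leq_maxr.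
move=> k; have [mF Fk] := Foo k; have [mG Gk] := Goo k; split.
  rewrite -[X in measurable X]setTI; apply: measurable_rV_uncons => //.
  exact: measurableX.
rewrite /lebesgue_rV_cons /pushforward.
rewrite (_ : _ @^-1` _ = F k `*` G k); last first.
  by apply/seteqP; split=> p; rewrite /preimage /mkset rV_consK.
by rewrite product_measure1E// lte_mul_pinfty// ge0_fin_numE.
Qed.

HB.instance Definition _ := Measure_isSigmaFinite.Build _ _ _ lebesgue_rV_cons
  cons_sigma_finite.

End lebesgue_rV_step.

(* Lebesgue measure on R^n, as an n-fold product of the one on R. *)
Fixpoint lebesgue_rV (R : realType) (n : nat) :
    {sigma_finite_measure set 'rV[R]_n -> \bar R} :=
  match n with
  | 0%N => @dirac _ 'rV[R]_0 (0 : 'rV[R]_0) R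
  | k.+1 => lebesgue_rV_cons (lebesgue_rV R k)
  end.

Lemma lebesgue_rV_box (R : realType) (n : nat) (B : 'I_n -> set R) :
  (forall i, measurable (B i)) ->
  lebesgue_rV R n [set x | forall i, B i (x ord0 i)] =
  (\prod_(i < n) @lebesgue_measure R (B i))%E.
Proof.
elim: n => [|n IH] in B *; move=> mB.
  rewrite big_ord0 /= diracE mem_set//; by case.
rewrite big_ord_recl -(IH (fun i : 'I_n => B (lift ord0 i))); last first.
  by move=> i; exact: mB.
have mS : measurable [set x : 'rV[R]_n | forall i, B (lift ord0 i) (x ord0 i)].
  have -> : [set x : 'rV[R]_n | forall i, B (lift ord0 i) (x ord0 i)] =
      \bigcap_(i in [set: 'I_n])
        ((fun x : 'rV[R]_n => x ord0 i) @^-1` B (lift ord0 i)).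
    by apply/seteqP; split=> [x Bx i _|x Bx i]; exact: Bx.
  apply: fin_bigcap_measurable => // i _.
  by rewrite -[X in measurable X]setTI; apply: measurable_coord => //; exact: mB.
rewrite /= /lebesgue_rV_cons /pushforward -product_measure1E; last 2 first.
- exact: mB.
- exact: mS.
congr (_ _); apply/seteqP; split=> [p Bp|p [/= Bp0 Bp] i] /=.
  split=> [|i /=]; first by rewrite -rV_cons0; exact: Bp.
  by rewrite -rV_consS; exact: Bp.
by case: (unliftP ord0 i) => [j|] ->; rewrite ?rV_consS ?rV_cons0.
Qed.

Section linear_algebra.
Context {K : pzRingType} {V : lmodType K}.

Definition lspan (S : set V) : set V :=
  [set v | exists (s : seq V) (c : V -> K),
     {in s, forall u, S u} /\ v = \sum_(u <- s) c u *: u].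

Definition lfree (I : choiceType) (J : set I) (e : I -> V) : Prop :=
  forall (s : seq I) (c : I -> K), uniq s -> {in s, forall i, J i} ->
    \sum_(i <- s) c i *: e i = 0 -> {in s, forall i, c i = 0}.

(* (e i)_(i in J) is a basis of the linear subspace W. It is read as a family,
   so that the e i are in particular pairwise distinct. *)
Definition lbasis (I : choiceType) (J : set I) (e : I -> V) (W : set V) :=
  lfree J e /\ lspan (e @` J) = W.

End linear_algebra.

Definition is_norm (R : realType) (V : lmodType R) (nu : V -> R) : Prop :=
  [/\ forall x y, nu (x + y) <= nu x + nu y,
      forall (a : R) x, nu (a *: x) = `|a| * nu x &
      forall x, nu x = 0 -> x = 0].

(* A is the set of values of X and f its density. As to "support", f vanishes
   outside A and every point of A is a limit of points where f does not vanish;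
   this holds when A is the closure of {f != 0}, and also when A = {f != 0}.
   The density is only required to be continuous on A, as for a uniform density
   on a cube. An absolutely continuous joint distribution function is understood
   as a law dominated by Lebesgue measure. *)
Record admissible_law (d : measure_display) (Omega : measurableType d)
    (R : realType) (P : probability Omega R) (N : nat) (A : set 'rV[R]_N)
    (X : {RV P >-> 'rV[R]_N}) (f : 'rV[R]_N -> R) : Prop := AdmissibleLaw {
  al_measurable : measurable A ;
  al_range : forall w, A (X w) ;
  al_abs_cont : distribution P X `<< lebesgue_rV R N ;
  al_pdf_measurable : measurable_fun [set: 'rV[R]_N] f ;
  al_pdf_ge0 : forall x, 0 <= f x ;
  al_pdf : forall B, measurable B ->
    distribution P X B = (\int[lebesgue_rV R N]_(x in B) (f x)%:E)%E ;
  al_pdf_continuous : {within A, continuous f} ;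
  al_support : [set x | f x != 0] `<=` A /\ A `<=` closure [set x | f x != 0] ;
  al_moments : forall j : multinom N,
    (\int[lebesgue_rV R N]_(x in A)
       (`|\prod_(i < N) x ord0 i ^+ j i| * f x)%:E < +oo)%E ;
  al_tail :
    (exists C : set 'rV[R]_N, compact C /\ P (X @^-1` C) = 1%E) \/
    (exists nu : 'rV[R]_N -> R, is_norm nu /\ exists alpha : R, 0 < alpha /\
       (\int[lebesgue_rV R N]_(x in A) (expR (alpha * nu x) * f x)%:E < +oo)%E)
}.

Section polynomials.
Context {R : realType} {N : nat}.
Implicit Types (A : set 'rV[R]_N) (f : 'rV[R]_N -> R) (p q : mpoly N R).

Definition Pi_le (m : nat) : set (mpoly N R) :=
  lspan [set mpolyX R j | j in [set j : multinom N | (mdeg j <= m)%N]].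

Definition inner A f p q : R :=
  \int[lebesgue_rV R N]_(x in A)
     (meval (x ord0) p * meval (x ord0) q * f x).

Definition Vspace A f (l : nat) : set (mpoly N R) :=
  match l with
  | 0%N => lspan [set 1]
  | k.+1 => [set p | Pi_le k.+1 p /\ forall q, Pi_le k q -> inner A f p q = 0]
  end.

End polynomials.

Definition K_ (N l : nat) : nat := 'C(N + l - 1, l).

Record monomial_order (N : nat) (le : rel (multinom N)) : Prop :=
  MonomialOrder {
  mo_total : total le ;
  mo_anti : antisymmetric le ;
  mo_trans : transitive le ;
  mo_add : forall i j k, le i j -> le (mnm_add i k) (mnm_add j k) ;
  mo_zero : forall j, le mnm0 j
}.

(* mi l lists the multi-indices of degree l, increasingly for le. *)
Definition monomial_listing (N : nat) (le : rel (multinom N))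
    (mi : forall l, (K_ N l).-tuple (multinom N)) : Prop :=
  forall l, [/\ sorted le (mi l), uniq (mi l) &
                forall j, (j \in mi l) = (mdeg j == l)].

(* The matrix of the integrals of x_r P_l^T f over A, where x_r and P_l are the
   columns of the monomials and of the P_j of degree r and l. *)
Definition moment_mx (R : realType) (N : nat) (A : set 'rV[R]_N)
    (f : 'rV[R]_N -> R) (mi : forall l, (K_ N l).-tuple (multinom N))
    (P : multinom N -> mpoly N R) (r l : nat) : 'M[R]_(K_ N r, K_ N l) :=
  \matrix_(a, b) inner A f (mpolyX R (tnth (mi r) a)) (P (tnth (mi l) b)).

Record consistent_orthogonal (R : realType) (N : nat) (A : set 'rV[R]_N)
    (f : 'rV[R]_N -> R) (mi : forall l, (K_ N l).-tuple (multinom N))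
    (P : multinom N -> mpoly N R) : Prop := ConsistentOrthogonal {
  co_zero : P mnm0 = 1 ;
  co_degree : forall j, Pi_le (mdeg j) (P j) ;
  co_orth : forall r l, (r < l)%N -> moment_mx A f mi P r l = 0 ;
  co_unit : forall l, moment_mx A f mi P l l \in unitmx
}.

(* Main.v *)
Require Import Defs.
From HB Require Import structures.
From mathcomp Require Import all_boot all_order all_algebra.
From mathcomp Require Import -(notations) mpoly.
From mathcomp Require Import all_classical all_reals all_analysis.
From mathcomp Require Import measurable_realfun.

Set Implicit Arguments.
Unset Strict Implicit.
Unset Printing Implicit Defensive.
Import Order.TTheory GRing.Theory Num.Theory.
Import numFieldNormedType.Exports.
Local Open Scope classical_set_scope.
Local Open Scope ring_scope.

(** The inner product of p and q is L (p * q), where L p is the integral of p f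
    over A. Finiteness of all moments makes L a linear form, and the rest of the
    argument is linear algebra, in which the nondegeneracy of L in each degree is
    drawn from the invertibility of the matrices S_l.

    Call L nondegenerate below m if 0 is the only polynomial of degree less than
    m that is orthogonal to all polynomials of degree less than m. Nondegeneracy
    holds trivially below 0, and the basis property at level l links
    nondegeneracy below l to nondegeneracy below l + 1, as follows.

    Linear independence of the P_j with |j| = l is immediate: pairing a vanishing
    combination with the monomials of degree l gives S_l v = 0 for its vector of
    coefficients v, hence v = 0 (comb_eq0).

    To see that they span, let C be the square matrix of the coefficients of the
    P_j, |j| = l, at the monomials of degree l. A vector in the kernel of C gives
    a combination of the P_j of degree less than l; it is also orthogonal to all
    polynomials of degree less than l, so it vanishes by nondegeneracy below l,
    and so does the vector. Thus C is invertible (leading_mx_unit). An element p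
    of V_l then has the same part of degree l as some combination of the P_j, and
    the difference vanishes, again by nondegeneracy below l (orth_space_comb).

    Finally, if p of degree at most l is orthogonal to all polynomials of degree
    at most l, it is in V_l, hence a combination of the P_j with coefficients v,
    and pairing with the monomials of degree l gives S_l v = 0, so p = 0: L is
    nondegenerate below l + 1 (nondegenerate). *)

(** * Spans *)

Section span.
Context {K : pzRingType} {V : lmodType K}.

Lemma lspan_min (S W : set V) :
  W 0 -> (forall (a : K) u v, W u -> W v -> W (a *: u + v)) ->
  S `<=` W -> lspan S `<=` W.
Proof.
move=> W0 WL SW _ [s [c [sS ->]]].
rewrite big_seq; elim/big_rec: _ => // u v us Wv.
by apply: WL => //; apply/SW/sS.
Qed.

(** The coefficients of an element of a span are a function of the vector, so
    the indices with the same vector have to be grouped. *)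
Lemma lspan_sum (I : choiceType) (J : set I) (e : I -> V) (r : seq I)
    (c : I -> K) :
  {in r, forall i, J i} -> lspan (e @` J) (\sum_(i <- r) c i *: e i).
Proof.
move=> rJ; exists (undup (map e r)), (fun u => \sum_(i <- r | e i == u) c i).
split=> [u|]; first by rewrite mem_undup => /mapP[i ir ->]; exists i => //; exact: rJ.
under [RHS]eq_bigr do rewrite /= scaler_suml.
rewrite (exchange_big_dep xpredT)//=.
rewrite [RHS]big_seq [LHS]big_seq; apply: eq_bigr => i ir.
have ei : e i \in undup (map e r) by rewrite mem_undup map_f.
rewrite big_mkcond (bigD1_seq (e i)) ?undup_uniq//= eqxx big1 ?addr0// => u.
by rewrite eq_sym => /negbTE ->.
Qed.

End span.

(** * Polynomials of bounded degree *)

Section degree.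
Context {K : fieldType} {N : nat}.
Implicit Types (p q : mpoly N K).

(** A bound on the coefficients rather than on the degree, so that 0 needs no
    convention and linear combinations no case analysis. *)
Definition deg_lt (m : nat) : set (mpoly N K) :=
  [set p | forall j, (m <= mdeg j)%N -> mcoeff j p = 0].

Lemma deg_lt0 m : deg_lt m 0.
Proof. by move=> j _; rewrite mcoeff0. Qed.

Lemma deg_ltL m (a : K) p q : deg_lt m p -> deg_lt m q -> deg_lt m (a *: p + q).
Proof. by move=> dp dq j mj; rewrite mcoeffD mcoeffZ dp// dq// mulr0 addr0. Qed.

Lemma deg_lt_sum m (I : Type) (r : seq I) (c : I -> K) (p : I -> mpoly N K) :
  (forall i, deg_lt m (p i)) -> deg_lt m (\sum_(i <- r) c i *: p i).
Proof.
move=> dp; elim/big_rec: _ => [|i q _]; first exact: deg_lt0.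
exact: deg_ltL.
Qed.

Lemma span_monomials_deg_lt m :
  lspan [set mpolyX K j | j in [set j : multinom N | (mdeg j <= m)%N]] =
  deg_lt m.+1.
Proof.
apply/seteqP; split=> [|p dp].
  apply: lspan_min => [|a u v|_ [j jm <-] i mi]; [exact: deg_lt0|exact: deg_ltL|].
  rewrite mcoeffX; case: eqP => // ji; move: mi; rewrite -ji ltnNge.
  by rewrite (jm : is_true (mdeg j <= m)%N).
rewrite (mpolyE p); apply: lspan_sum => j; rewrite mcoeff_msupp /= leqNgt.
by apply: contra => jm; apply/eqP/dp.
Qed.

End degree.

(** * Orthogonal polynomials of a linear form *)

Section orthogonal_basis.
Context {K : fieldType} {N : nat} (L : {scalar mpoly N K}).
Context (k : nat -> nat) (mi : forall l, (k l).-tuple (multinom N)).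
Context (P : multinom N -> mpoly N K).

Let e l (a : 'I_(k l)) : multinom N := tnth (mi l) a.

Definition orth_below (m : nat) : set (mpoly N K) :=
  [set p | forall j : multinom N, (mdeg j < m)%N -> L (mpolyX K j * p) = 0].

Lemma orth_below0 m : orth_below m 0.
Proof. by move=> j _; rewrite mulr0 linear0. Qed.

Lemma orth_belowL m (a : K) p q :
  orth_below m p -> orth_below m q -> orth_below m (a *: p + q).
Proof.
by move=> dp dq j mj; rewrite mulrDr -scalerAr linearP /= dp// dq// mulr0 addr0.
Qed.

(** The space V_l, with no special case at l = 0, where orthogonality is void. *)
Definition orth_space (l : nat) : set (mpoly N K) :=
  deg_lt l.+1 `&` orth_below l.

Definition nondegenerate_below (m : nat) : Prop :=
  deg_lt m `&` orth_below m `<=` [set 0].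

(** The matrix S_l. *)
Definition moments l : 'M[K]_(k l) :=
  \matrix_(a, b) L (mpolyX K (e a) * P (e b)).

Context (mi_uniq : forall l, uniq (mi l)).
Context (mi_mem : forall l j, (j \in mi l) = (mdeg j == l)).
Context (P_orth_space : forall j, orth_space (mdeg j) (P j)).
Context (moments_unit : forall l, moments l \in unitmx).

Let mdeg_e l (a : 'I_(k l)) : mdeg (e a) = l.
Proof. by apply/eqP; rewrite -mi_mem mem_tnth. Qed.

Let degree_index l j : mdeg j = l -> exists a : 'I_(k l), j = e a.
Proof. by move=> /eqP; rewrite -mi_mem => /tnthP. Qed.

Let comb l (v : 'rV[K]_(k l)) : mpoly N K := \sum_b v ord0 b *: P (e b).

Let comb_orth_space l (v : 'rV_(k l)) : orth_space l (comb v).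
Proof.
have H (b : 'I_(k l)) : orth_space l (P (e b)).
  by rewrite -[X in orth_space X](mdeg_e b); exact: P_orth_space.
split; first by apply: deg_lt_sum => b; case: (H b).
rewrite /comb; elim/big_rec: _ => [|b q _ oq]; first exact: orth_below0.
by apply: orth_belowL => //; case: (H b).
Qed.

Let orth_spaceB l p (v : 'rV_(k l)) :
  orth_space l p -> orth_space l (p - comb v).
Proof.
case=> dp op; have [dv ov] := comb_orth_space v.
rewrite addrC -scaleN1r.
by split; [exact: deg_ltL|exact: orth_belowL].
Qed.

(* Combinations have row vectors of coefficients, whence the transpose. *)
Let moment_comb l (v : 'rV_(k l)) a :
  L (mpolyX K (e a) * comb v) = (v *m (moments l)^T) ord0 a.
Proof.
rewrite mxE mulr_sumr linear_sum /=; apply: eq_bigr => b _.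
by rewrite -scalerAr linearZ /= !mxE.
Qed.

Let moments_inj l (v : 'rV_(k l)) : v *m (moments l)^T = 0 -> v = 0.
Proof.
have Su : (moments l)^T \in unitmx by rewrite unitmx_tr.
by move=> vS; rewrite -(mulmxK Su v) vS mul0mx.
Qed.

Lemma comb_eq0 l (v : 'rV_(k l)) : comb v = 0 -> v = 0.
Proof.
move=> v0; apply: moments_inj; apply/rowP => a.
by rewrite -moment_comb v0 mulr0 linear0 mxE.
Qed.

Definition leading_mx l : 'M[K]_(k l) := \matrix_(b, a) mcoeff (e a) (P (e b)).

Let mcoeff_comb l (v : 'rV_(k l)) a :
  mcoeff (e a) (comb v) = (v *m leading_mx l) ord0 a.
Proof.
rewrite mxE raddf_sum /=; apply: eq_bigr => b _.
by rewrite mcoeffZ mxE.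
Qed.

Let deg_lt_leading l (p : mpoly N K) : deg_lt l.+1 p ->
  (forall a : 'I_(k l), mcoeff (e a) p = 0) -> deg_lt l p.
Proof.
move=> dp p0 j; rewrite leq_eqVlt => /orP[/eqP/esym/degree_index[a ->]|] //.
exact: dp.
Qed.

(** The matrix is square, so it suffices that no nonzero combination of the P_j
    loses its part of degree l; such a combination would have degree less than l
    and be orthogonal to all polynomials of such degrees. *)
Lemma leading_mx_unit l : nondegenerate_below l -> leading_mx l \in unitmx.
Proof.
move=> nd; rewrite -row_free_unit; apply: inj_row_free => v vC.
apply: comb_eq0; have [dv ov] := comb_orth_space v.
apply: nd; split=> //; apply: deg_lt_leading => // a.
by rewrite mcoeff_comb vC mxE.
Qed.

(** The combination is chosen to match the part of p of degree l; the difference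
    then has degree less than l while still orthogonal to those degrees. *)
Lemma orth_space_comb l p : nondegenerate_below l -> orth_space l p ->
  exists v : 'rV_(k l), p = comb v.
Proof.
move=> nd op; pose u := \row_a mcoeff (e a) p : 'rV_(k l).
exists (u *m invmx (leading_mx l)); apply/subr0_eq.
have [dq oq] := orth_spaceB (u *m invmx (leading_mx l)) op.
apply: (nd); split=> //; apply: deg_lt_leading => // a.
by rewrite mcoeffB mcoeff_comb mulmxKV; [rewrite mxE subrr|exact: leading_mx_unit].
Qed.

(** By induction on l: below l.+1, a polynomial of the radical is a combination of
    the P_j of degree l, and S_l kills its coefficients. *)
Lemma nondegenerate l : nondegenerate_below l.
Proof.
elim: l => [|l nd] p [dp op]; first by apply/mpolyP => j; rewrite dp ?mcoeff0.
have [|v pv] := orth_space_comb nd (p := p).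
  by split=> // j jl; apply: op; exact: ltnW.
suff v0 : v = 0 by rewrite pv v0 /comb big1// => b _; rewrite mxE scale0r.
apply: moments_inj; apply/rowP => a; rewrite -moment_comb -pv mxE op//.
by rewrite mdeg_e.
Qed.

Theorem orthogonal_basis l :
  lbasis [set j : multinom N | mdeg j = l] P (orth_space l).
Proof.
split=> [s c us sl s0 i si|].
  (* Extend the coefficients by zero from s to all indices of degree l. *)
  pose v := \row_(a < k l) (if e a \in s then c (e a) else 0).
  have v0 : v = 0.
    apply: comb_eq0; rewrite -[RHS]s0 /comb.
    transitivity (\sum_(j <- mi l | j \in s) c j *: P j).
      rewrite big_tuple [RHS]big_mkcond /=; apply: eq_bigr => a _.
      by rewrite mxE; case: ifP => //; rewrite scale0r.
    rewrite -big_filter; apply/perm_big/uniq_perm => //.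
      exact/filter_uniq/mi_uniq.
    move=> j; rewrite mem_filter; apply: andb_idr => js.
    by rewrite mi_mem; apply/eqP/sl.
  have [a ia] := degree_index (sl i si).
  by move: (congr1 (fun w : 'rV_(k l) => w ord0 a) v0); rewrite !mxE -ia si.
apply/seteqP; split.
  apply: lspan_min => [|a u v [du ou] [dv ov]|_ [j jl <-]].
  - by split; [exact: deg_lt0|exact: orth_below0].
  - by split; [exact: deg_ltL|exact: orth_belowL].
  - by rewrite -(jl : mdeg j = l); exact: P_orth_space.
move=> p /(orth_space_comb (@nondegenerate l))[v ->].
rewrite /comb.
(* The inner sum has one term: it turns coefficients indexed by positions in the
   listing into coefficients indexed by multi-indices. *)
have -> : \sum_b v ord0 b *: P (e b) =
    \sum_(j <- mi l) (\sum_(b | e b == j) v ord0 b) *: P j.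
  rewrite big_tuple; apply: eq_bigr => b _; congr (_ *: _).
  rewrite (big_pred1 b)// => c; apply/eqP/eqP => [|->//].
  exact/tuple_uniqP.
by apply: lspan_sum => j; rewrite mi_mem => /eqP.
Qed.

End orthogonal_basis.

(** * The linear form of a density with finite moments *)

Section integration.
Context {R : realType} {N : nat} (A : set 'rV[R]_N) (f : 'rV[R]_N -> R).

Definition expectation (p : mpoly N R) : R :=
  \int[lebesgue_rV R N]_(x in A) (meval (x ord0) p * f x).

Lemma innerE p q : inner A f p q = expectation (p * q).
Proof. by apply: eq_Rintegral => x _; rewrite mevalM. Qed.

Context (mA : measurable A).
Context (mf : measurable_fun setT f).
Context (f_ge0 : forall x, 0 <= f x).
Context (moments_finite : forall j : multinom N,
  (\int[lebesgue_rV R N]_(x in A)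
       (`|\prod_(i < N) x ord0 i ^+ j i| * f x)%:E < +oo)%E).

Lemma integrable_monomial (j : multinom N) :
  (lebesgue_rV R N).-integrable A
    (EFin \o (fun x : 'rV[R]_N => meval (x ord0) (mpolyX R j) * f x)).
Proof.
under eq_fun do rewrite /= mevalX.
apply/integrableP; split.
  apply/measurable_EFinP; apply: (measurable_funS measurableT) => //.
  apply: measurable_funM => //; apply: measurable_prod => i _.
  by apply: measurable_funX; exact: measurable_coord.
under eq_integral do rewrite abse_EFin normrM (ger0_norm (f_ge0 _)).
exact: moments_finite.
Qed.

Lemma integrable_poly (p : mpoly N R) :
  (lebesgue_rV R N).-integrable A (EFin \o (fun x : 'rV[R]_N => meval (x ord0) p * f x)).
Proof.
rewrite (mpolyE p).
have -> : EFin \o (fun x : 'rV[R]_N =>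
    meval (x ord0) (\sum_(m <- msupp p) mcoeff m p *: mpolyX R m) * f x) =
  (fun x : 'rV[R]_N => \sum_(m <- msupp p)
    ((mcoeff m p)%:E * (meval (x ord0) (mpolyX R m) * f x)%:E))%E.
  apply/funext => x /=; rewrite raddf_sum mulr_suml /= -sumEFin.
  by apply: eq_bigr => m _; rewrite mevalZ -mulrA EFinM.
by apply: integrable_sum => // m _; apply: integrableZl => //; exact: integrable_monomial.
Qed.

(** The integral is only additive on integrable functions; this is where the
    finiteness of the moments enters. *)
Lemma expectation_linear : scalar expectation.
Proof.
move=> a p q; rewrite /expectation -RintegralZl//; last exact: integrable_poly.
rewrite -RintegralD//; last exact: integrable_poly.
  by apply: eq_Rintegral => x _; rewrite mevalD mevalZ mulrDl mulrA.
exact: (integrableZl mA a (integrable_poly p)).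
Qed.

End integration.

(** Orthogonality to all polynomials of degree less than l is tested on monomials,
    and for l = 0 the constants are the span of the monomial of degree 0. *)
Lemma Vspace_orth_space (R : realType) (N : nat) (A : set 'rV[R]_N)
    (f : 'rV[R]_N -> R) (L : {scalar mpoly N R}) (l : nat) :
  (forall p q, inner A f p q = L (p * q)) -> Vspace A f l = orth_space L l.
Proof.
move=> LE; case: l => [|l] /=.
  have -> : [set 1 : mpoly N R] =
      [set mpolyX R j | j in [set j : multinom N | (mdeg j <= 0)%N]].
    apply/seteqP; split=> [_ ->|_ [j j0 <-]].
      by exists mnm0; [rewrite /= mdeg0|rewrite mpolyX0].
    by move: j0; rewrite /= leqn0 mdeg_eq0 => /eqP ->; rewrite mpolyX0.
  by rewrite span_monomials_deg_lt; apply/seteqP; split=> [p dp|p []].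
rewrite /orth_space /Pi_le !span_monomials_deg_lt.
apply/seteqP; split=> p [dp op]; split=> //.
  move=> j jl; rewrite mulrC -LE; apply: op => i li; rewrite mcoeffX.
  by case: eqP => // ji; move: jl; rewrite ji ltnNge li.
move=> q; rewrite -span_monomials_deg_lt LE.
pose W := [set q | L (p * q) = 0].
apply: (@lspan_min _ _ _ W); rewrite /W /=.
- by rewrite mulr0 linear0.
- by move=> a u v pu pv; rewrite mulrDr -scalerAr linearP /= pu pv mulr0 addr0.
- by move=> _ [j jl <-] /=; rewrite mulrC op.
Qed.

Theorem proposition3 (R : realType) (d : measure_display)
  (Omega : measurableType d) (P : probability Omega R)
  (hP : measure_is_complete P)
  (N : nat) (hN : (0 < N)%N)
  (A : set 'rV[R]_N) (X : {RV P >-> 'rV[R]_N}) (f : 'rV[R]_N -> R)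
  (hX : admissible_law A X f)
  (le : rel (multinom N)) (hle : monomial_order le)
  (mi : forall l, (K_ N l).-tuple (multinom N))
  (hmi : monomial_listing le mi)
  (Pj : multinom N -> mpoly N R)
  (hPj : consistent_orthogonal A f mi Pj) (l : nat) :
  lbasis [set j : multinom N | mdeg j = l] Pj (Vspace A f l).
Proof.
have Llin := expectation_linear (al_measurable hX) (al_pdf_measurable hX)
  (al_pdf_ge0 hX) (al_moments hX).
pose Lmix := GRing.isLinear.Build R (mpoly N R) R *%R (expectation A f) Llin.
pose L : {scalar mpoly N R} := HB.pack (expectation A f) Lmix.
have LE p q : inner A f p q = L (p * q) by exact: innerE.
have mi_mem m j : (j \in mi m) = (mdeg j == m) by have [_ _] := hmi m.
rewrite (Vspace_orth_space l LE).
apply: (orthogonal_basis (mi := mi)) => //.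
- by move=> m; have [] := hmi m.
- move=> j; split; first by rewrite -span_monomials_deg_lt; exact: co_degree hPj j.
  move=> i ij; rewrite -LE.
  have /tnthP[a ->] : i \in mi (mdeg i) by rewrite mi_mem.
  have /tnthP[b jb] : j \in mi (mdeg j) by rewrite mi_mem.
  have /matrixP/(_ a b) := co_orth hPj ij.
  by rewrite !mxE -jb.
- move=> m; suff -> : moments L mi Pj m = moment_mx A f mi Pj m m.
    exact: co_unit hPj m.
  by apply/matrixP => a b; rewrite !mxE LE.
Qed.
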